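(* Let $n$ be a positive integer with $n\equiv 0\pmod 2$. Fix any Type IV code $C$ of length $n$ and, for $0\le k\le\frac n2$, let $L_k^{\mathrm{IV}}(n)$ be the number of Type IV codes of length $n$ that are $k$-neighbors of $C$. Then the number of Type IV codes of length $n$ is $$\sum_{k=0}^{n/2}L_k^{\mathrm{IV}}(n).$$
   Context: Equip $\mathbb{F}_4^n$ with the Hermitian inner product $u\cdot v=\sum_{i=1}^n u_iv_i^2$. A code of length $n$ over $\mathbb{F}_4$ is an $\mathbb{F}_4$-linear subspace $C\subseteq\mathbb{F}_4^n$; its dual is $C^\perp=\{v\in\mathbb{F}_4^n : u\cdot v=0\text{ for all }u\in C\}$, and $C$ is self-dual if $C=C^\perp$ (so $\dim C=n/2$). The weight of a vector is its number of nonzero coordinates. A Type IV code is a self-dual code over $\mathbb{F}_4$ in which every codeword has even weight. Codes are counted as subspaces (not up to equivalence). For $0\le k\le n/2$, two self-dual codes $C,D$ of length $n$ are $k$-neighbors if $\dim(C\cap D)=\frac n2-k$ (in particular, the only $0$-neighbor of $C$ is $C$ itself). *)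

(* Defs.v *)
From HB Require Import structures.
From mathcomp Require Import all_boot all_order all_algebra.

Set Implicit Arguments.
Unset Strict Implicit.
Unset Printing Implicit Defensive.

Import GRing.Theory.
Local Open Scope ring_scope.

(* Over a finite field, a vector space has finitely many subspaces; this lets
   codes be counted with the cardinality of finite types. *)
HB.instance Definition _ (F : finFieldType) (vT : vectType F) :=
  CanIsCountable (@VectorInternalTheory.vs2mxK F vT).
HB.instance Definition _ (F : finFieldType) (vT : vectType F) :
    isFinite {vspace vT} :=
  CanIsFinite (@VectorInternalTheory.vs2mxK F vT).

Section Codes.

(* The definitions make sense for every finite field; the form [hdot] is the
   Hermitian inner product when F has 4 elements. *)
Variables (F : finFieldType) (n : nat).

Implicit Types (C D : {vspace 'rV[F]_n}) (u v : 'rV[F]_n).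

Definition hdot u v : F := \sum_(i < n) u 0 i * v 0 i ^+ 2.

Definition dual C : {set 'rV[F]_n} :=
  [set v | [forall u, (u \in C) ==> (hdot u v == 0)]].

Definition self_dual C : bool := [set v | v \in C] == dual C.

Definition weight v : nat := #|[set i | v 0 i != 0]|.

Definition typeIV C : bool :=
  self_dual C && [forall v, (v \in C) ==> ~~ odd (weight v)].

Definition k_neighbor (k : nat) C D : bool :=
  [&& (k <= n./2)%N, self_dual C, self_dual D
    & \dim (C :&: D) == (n./2 - k)%N].

Definition num_typeIV : nat := #|[set D : {vspace 'rV[F]_n} | typeIV D]|.

Definition L_IV C (k : nat) : nat :=
  #|[set D : {vspace 'rV[F]_n} | typeIV D && k_neighbor k C D]|.

End Codes.

(* Main.v *)
Require Import Defs.
From HB Require Import structures.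
From mathcomp Require Import all_boot all_order all_algebra.
From mathcomp Require Import finfield.
Import GRing.Theory.

(** The Type IV codes of length n are sorted by k = n/2 - dim (C :&: D).  Every
    such code D falls in exactly one class with 0 <= k <= n/2, because
    dim (C :&: D) <= dim C <= n/2; so counting the codes is the same as adding
    up the sizes of the classes.

    The bound dim C <= n/2 is where the Hermitian product enters
    ([dim_self_dual]): for a matrix M whose rows are a basis of C,
    self-orthogonality says that M times the transpose of its conjugate
    vanishes.  Conjugation is the Frobenius map x |-> x ^ 2, which
    preserves rank, so twice the rank of M is at most n. *)

Lemma row_free_vbasis {F : fieldType} {n} (C : {vspace 'rV[F]_n}) :
  row_free (\matrix_(i < \dim C) (vbasis C)`_i)%R.
Proof.
apply: inj_row_free => v; rewrite mulmx_sum_row => v0.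
apply/rowP => i; rewrite mxE.
have /freeP freeC := basis_free (vbasisP C); apply: (freeC (v 0%R)).
by rewrite -[RHS]v0; apply: eq_bigr => j _; rewrite rowK.
Qed.

Lemma hdot_self_dual {F : finFieldType} {n} {C : {vspace 'rV[F]_n}} {u v} :
  self_dual C -> u \in C -> v \in C -> hdot u v = 0%R.
Proof.
move=> /eqP/setP/(_ v); rewrite !inE => Cv Cu vC.
by move: Cv; rewrite vC => /esym/forallP/(_ u); rewrite Cu => /eqP.
Qed.

(** In characteristic 2 the entrywise square of a matrix is its image under a
    field morphism, so it has the same rank; rank-nullity then gives the bound
    from the orthogonality of the basis vectors. *)
Lemma dim_self_dual {F : finFieldType} {n} {C : {vspace 'rV[F]_n}} :
  2 \in [pchar F]%R -> self_dual C -> \dim C <= n./2.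
Proof.
move=> ch2 sdC; set M := (\matrix_(i < \dim C) (vbasis C)`_i)%R.
have rkM : \rank M = \dim C by apply/eqP; apply: row_free_vbasis.
have inC (i : 'I_(\dim C)) : ((vbasis C)`_i)%R \in C.
  by apply: vbasis_mem; apply: mem_nth; rewrite size_tuple.
have M0 : (M *m (map_mx (pFrobenius_aut ch2) M)^T = 0)%R.
  apply/matrixP => i j; rewrite mxE [RHS]mxE.
  rewrite -[RHS](hdot_self_dual sdC (inC i) (inC j)).
  by apply: eq_bigr => k _; rewrite !mxE pFrobenius_autE.
have := mulmx0_rank_max M0.
by rewrite mxrank_tr mxrank_map rkM addnn geq_half_double.
Qed.

Theorem theorem5p16 (F : finFieldType) (hF : #|F| = 4) (n : nat)
    (n_gt0 : 0 < n) (n_even : n = 0 %[mod 2])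
    (C : {vspace 'rV[F]_n}) (hC : typeIV C) :
  num_typeIV F n = \sum_(0 <= k < (n./2).+1) L_IV C k.
Proof.
have ch2 : 2 \in [pchar F]%R by apply: (@card_finPcharP F 2 2).
have /andP[sdC _] := hC.
rewrite /num_typeIV cardsE -sum1_card.
under [RHS]eq_bigr => k _ do rewrite /L_IV cardsE -sum1_card big_mkcondr.
rewrite exchange_big; apply: eq_bigr => D /andP[sdD _].
have le_dim : \dim (C :&: D) <= n./2.
  exact: leq_trans (dimvS (capvSl C D)) (dim_self_dual ch2 sdC).
rewrite big_mkord (bigD1 (inord (n./2 - \dim (C :&: D)))) //=.
rewrite inordK ?ltnS ?leq_subr // {1}/k_neighbor leq_subr sdC sdD subKn // eqxx.
rewrite big1 // => k neq_k; case: ifP => // /and4P[le_k _ _ /eqP dimE].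
by rewrite dimE subKn // inord_val eqxx in neq_k.
Qed.
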